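(* Let $T:V\to L$ be an $\mathcal{O}$-operator on a L.t.sRep pair $(L,[\cdot,\cdot,\cdot];\theta)$, with $\theta$ a representation on $V$. Define $\theta_T:\otimes^2V\to gl(L)$ by $$\theta_T(u,v)x=[x,Tu,Tv]+T\big(\theta(x,Tv)u-D(x,Tu)v\big),\qquad x\in L,\ u,v\in V.$$ Then $(L,\theta_T)$ is a representation of the Lie triple system $(V,[\cdot,\cdot,\cdot]_T)$ on $L$, where $[u,v,w]_T=D(Tu,Tv)w+\theta(Tv,Tw)u-\theta(Tu,Tw)v$ for $u,v,w\in V$.
   Context: All vector spaces are over a field of characteristic $0$. A Lie triple system (L.t.s) is a vector space $L$ with a trilinear bracket $[\cdot,\cdot,\cdot]:\wedge^2L\otimes L\to L$ (skew-symmetric in the first two arguments) such that for all $x,y,z,t,e\in L$: $[x,y,z]+[y,z,x]+[z,x,y]=0$ and $[x,y,[z,t,e]]=[[x,y,z],t,e]+[z,[x,y,t],e]+[z,t,[x,y,e]]$. A representation of a L.t.s $L$ on a vector space $V$ is a bilinear map $\theta:\otimes^2L\to End(V)$ such that, with $D(x,y)=\theta(y,x)-\theta(x,y)$, for all $x,y,z,t\in L$: $\theta(z,t)\theta(x,y)-\theta(y,t)\theta(x,z)-\theta(x,[y,z,t])+D(y,z)\theta(x,t)=0$ and $\theta(z,t)D(x,y)-D(x,y)\theta(z,t)+\theta([x,y,z],t)+\theta(z,[x,y,t])=0$. A L.t.s together with a representation is called a L.t.sRep pair $(L,[\cdot,\cdot,\cdot];\theta)$. A linear map $T:V\to L$ is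 an $\mathcal{O}$-operator on the pair if $[Tu,Tv,Tw]=T\big(D(Tu,Tv)w+\theta(Tv,Tw)u-\theta(Tu,Tw)v\big)$ for all $u,v,w\in V$. It is known that in this case $(V,[\cdot,\cdot,\cdot]_T)$ is a L.t.s. *)

(* Defs.v *)
From HB Require Import structures.
From mathcomp Require Import all_boot all_order all_algebra.
Set Implicit Arguments.
Unset Strict Implicit.
Unset Printing Implicit Defensive.
Import GRing.Theory.
Local Open Scope ring_scope.

Section LieTripleSystems.
Variable K : fieldType.

Definition trilinear (A B C E : lmodType K) (f : A -> B -> C -> E) : Prop :=
  [/\ forall b c, linear (fun a => f a b c),
      forall a c, linear (fun b => f a b c)
    & forall a b, linear (f a b)].

Record is_lts (L : lmodType K) (br : L -> L -> L -> L) : Prop := IsLts {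
  lts_trilinear : trilinear br;
  lts_skew : forall x y z, br x y z = - br y x z;
  lts_cyclic : forall x y z, br x y z + br y z x + br z x y = 0;
  lts_deriv : forall x y z t e,
    br x y (br z t e)
    = br (br x y z) t e + br z (br x y t) e + br z t (br x y e)
}.

Section Representation.
Variables L V : lmodType K.

(* A bilinear map L (x) L -> End(V) is given in curried form: a map           *)
(* L -> L -> V -> V that is linear in each of its three arguments, linearity  *)
(* in the last one expressing that the values are endomorphisms of V.         *)
(* Identities between endomorphisms are stated pointwise.                     *)
Definition rep_D (theta : L -> L -> V -> V) (x y : L) (u : V) : V :=
  theta y x u - theta x y u.

Record is_representation (br : L -> L -> L -> L) (theta : L -> L -> V -> V) :
    Prop := IsRepresentation {
  rep_trilinear : trilinear theta;
  rep_theta : forall x y z t u,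
    theta z t (theta x y u) - theta y t (theta x z u)
    - theta x (br y z t) u + rep_D theta y z (theta x t u) = 0;
  rep_thetaD : forall x y z t u,
    theta z t (rep_D theta x y u) - rep_D theta x y (theta z t u)
    + theta (br x y z) t u + theta z (br x y t) u = 0
}.

(* [u, v, w]_T *)
Definition bracketT (theta : L -> L -> V -> V) (T : V -> L) (u v w : V) : V :=
  rep_D theta (T u) (T v) w + theta (T v) (T w) u - theta (T u) (T w) v.

Definition is_O_operator (br : L -> L -> L -> L) (theta : L -> L -> V -> V)
    (T : {linear V -> L}) : Prop :=
  forall u v w, br (T u) (T v) (T w)
    = T (rep_D theta (T u) (T v) w + theta (T v) (T w) u
         - theta (T u) (T w) v).

Definition thetaT (br : L -> L -> L -> L) (theta : L -> L -> V -> V)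
    (T : V -> L) (u v : V) (x : L) : L :=
  br x (T u) (T v) + T (theta x (T v) u - rep_D theta x (T u) v).

End Representation.
End LieTripleSystems.

(* Main.v *)
Require Import Defs.
From HB Require Import structures.
From mathcomp Require Import all_boot all_order all_algebra.
Set Implicit Arguments.
Unset Strict Implicit.
Unset Printing Implicit Defensive.
Import GRing.Theory.
Local Open Scope ring_scope.

(** The whole statement is read off from one larger Lie triple system.  The
representation [theta] makes the direct sum of [L] and [V] into a Lie triple
system, the semidirect product ([semidirect_is_lts]), in which the product of
[x + u], [y + v], [z + w] has [V]-component
[D(x,y) w + theta(y,z) u - theta(x,z) v].  The defining equation of an
O-operator says exactly that the graph of [T], the set of all [T u + u], is
closed under this product ([graph_bracket]), and [bracketT] is the product of
the graph transported to [V].  Hence [V] is a Lie triple system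
([lts_restrict]).

For any subsystem [H] of a Lie triple system [E], the quotient space [E / H] is
a representation of [H], with [theta(h, k)] induced by [e |-> [e, h, k]]
([quotient_is_representation]); both axioms of a representation are then
instances of the derivation identity of [E].  For the graph of [T], the map
[(x, u) |-> x - T u] identifies the quotient with [L], and the induced action
is [thetaT] ([thetaT_quotient]). *)

(** * Linear maps *)

Section LinearPredicate.
Variables (K : fieldType) (A E : lmodType K).

Lemma linear_addE (f : A -> E) : linear f -> {morph f : x y / x + y}.
Proof. by move=> lin_f x y; have := lin_f 1 x y; rewrite !scale1r. Qed.

Lemma linear_zeroE (f : A -> E) : linear f -> f 0 = 0.
Proof.
by move=> lin_f; have := lin_f (-1) 0 0; rewrite scaler0 addr0 scaleN1r addNr.
Qed.

Lemma linear_oppE (f : A -> E) : linear f -> {morph f : x / - x}.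
Proof.
move=> lin_f x; have := lin_f (-1) x 0.
by rewrite !addr0 !scaleN1r (linear_zeroE lin_f) addr0.
Qed.

Lemma linear_subE (f : A -> E) : linear f -> {morph f : x y / x - y}.
Proof.
by move=> lin_f x y; rewrite (linear_addE lin_f) (linear_oppE lin_f).
Qed.

End LinearPredicate.

(** * Transport of a product to a subsystem *)

Section Subsystem.
Variables (K : fieldType) (E H : lmodType K).
Variables (b : E -> E -> E -> E) (c : H -> H -> H -> H) (i : {linear H -> E}).
Hypotheses (ltsE : is_lts b) (i_inj : injective i).
Hypothesis ibr : forall x y z, i (c x y z) = b (i x) (i y) (i z).

Lemma lts_restrict : is_lts c.
Proof.
have [[lin1 lin2 lin3] skew cyc der] := ltsE.
split; first split.
- by move=> y z a x x'; apply: i_inj; rewrite linearP !ibr linearP lin1.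
- by move=> x z a y y'; apply: i_inj; rewrite linearP !ibr linearP lin2.
- by move=> x y a z z'; apply: i_inj; rewrite linearP !ibr linearP lin3.
- by move=> x y z; apply: i_inj; rewrite linearN !ibr skew.
- by move=> x y z; apply: i_inj; rewrite !linearD linear0 !ibr cyc.
- by move=> x y z t e; apply: i_inj; rewrite !linearD !ibr der.
Qed.

End Subsystem.

(** * The quotient by a subsystem *)

Section Quotient.
Variables (K : fieldType) (E H Q : lmodType K).
Variables (b : E -> E -> E -> E) (c : H -> H -> H -> H).
Variables (i : {linear H -> E}) (p : {linear E -> Q}) (s : {linear Q -> E}).
Hypothesis ltsE : is_lts b.
Hypothesis ibr : forall x y z, i (c x y z) = b (i x) (i y) (i z).
Hypothesis pi0 : forall h, p (i h) = 0.
Hypothesis kerp : forall e, p e = 0 -> exists h, e = i h.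
Hypothesis sK : cancel s p.

Definition quotient_theta (h k : H) (q : Q) : Q := p (b (s q) (i h) (i k)).

(** Two elements with the same image differ by an element of the subsystem,
which the action keeps inside the subsystem. *)
Lemma quotient_theta_proj h k e :
  quotient_theta h k (p e) = p (b e (i h) (i k)).
Proof.
have [[lin1 _ _] _ _ _] := ltsE.
have [g eg] : exists g, e - s (p e) = i g.
  by apply: kerp; rewrite linearB /= sK subrr.
rewrite /quotient_theta -{2}[e](subrK (s (p e))) eg (linear_addE (lin1 _ _)).
by rewrite -ibr linearD pi0 add0r.
Qed.

(** By the cyclic identity, the operator [D] of the quotient action is induced
by the inner derivation [b (i h) (i k)] of [E]. *)
Lemma quotient_D_proj h k e :
  rep_D quotient_theta h k (p e) = p (b (i h) (i k) e).
Proof.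
have [_ skew cyc _] := ltsE.
rewrite /rep_D !quotient_theta_proj -linearB; congr (p _).
apply/esym/eqP; rewrite -subr_eq0 -(cyc (i h) (i k) e) [b (i k) e _]skew.
by rewrite opprB addrA addrAC.
Qed.

Lemma quotient_is_representation : is_representation c quotient_theta.
Proof.
have [[lin1 lin2 lin3] skew _ der] := ltsE.
split; first split.
- by move=> k q a h h'; rewrite /quotient_theta linearP lin2 linearP.
- by move=> h q a k k'; rewrite /quotient_theta linearP lin3 linearP.
- by move=> h k a q q'; rewrite /quotient_theta linearP lin1 linearP.
- move=> x y z t u; rewrite -[u]sK !quotient_theta_proj quotient_D_proj.
  rewrite -!linearB -linearD ibr der [b (i y) _ (i t)]skew -[RHS](linear0 p).
  by congr (p _); rewrite opprD addrA addrNK subrr.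
- move=> x y z t u; rewrite -[u]sK !quotient_theta_proj !quotient_D_proj.
  rewrite !quotient_theta_proj -linearB -!linearD !ibr der -[RHS](linear0 p).
  by congr (p _); rewrite -!addrA opprD addrNK subrr.
Qed.

End Quotient.

(** * The semidirect product *)

Section Semidirect.
Variables (K : fieldType) (L V : lmodType K).
Variables (br : L -> L -> L -> L) (theta : L -> L -> V -> V).

Local Notation D := (rep_D theta).

Definition semidirect (p q r : (L * V)%type) : (L * V)%type :=
  (br p.1 q.1 r.1, D p.1 q.1 r.2 + theta q.1 r.1 p.2 - theta p.1 r.1 q.2).

Hypotheses (ltsL : is_lts br) (repV : is_representation br theta).

Lemma rep_D_trilinear : trilinear D.
Proof.
have [[lin1 lin2 lin3] _ _] := repV.
split=> [y u a x x' | x u a y y' | x y a u u']; rewrite /rep_D.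
- by rewrite lin1 lin2 scalerBr opprD addrACA.
- by rewrite lin1 lin2 scalerBr opprD addrACA.
- by rewrite !lin3 scalerBr opprD addrACA.
Qed.

Lemma rep_D_skew x y u : D x y u = - D y x u.
Proof. by rewrite /rep_D opprB. Qed.

Lemma rep_theta_br x y z t u :
  theta x (br y z t) u
  = theta z t (theta x y u) - theta y t (theta x z u) + D y z (theta x t u).
Proof.
by apply/esym/eqP; rewrite -subr_eq0 addrAC; apply/eqP/(rep_theta repV).
Qed.

(** Second axiom of a representation, read as a Leibniz rule: [D x y] acts as a
derivation on [theta] when [br x y] acts on [L]. *)
Lemma rep_D_theta x y z t u :
  D x y (theta z t u)
  = theta (br x y z) t u + theta z (br x y t) u + theta z t (D x y u).
Proof.
apply/esym/eqP; rewrite -subr_eq0 -[X in _ == X](rep_thetaD repV x y z t u).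
by rewrite (AC (2*1*1) (3*4*1*2)).
Qed.

(** Since [D] is a difference of values of [theta], it inherits the Leibniz rule
of [rep_D_theta]. *)
Lemma rep_D_D x y z t u :
  D x y (D z t u) = D (br x y z) t u + D z (br x y t) u + D z t (D x y u).
Proof.
have [_ _ lin3] := rep_D_trilinear.
rewrite [D z t u]/rep_D (linear_subE (lin3 x y)) !rep_D_theta /rep_D !opprD.
by rewrite !addrA [LHS](ACl (2*4*1*5*3*6)).
Qed.

(** The product is linear in the [V]-components jointly, each term containing
exactly one of them; so each axiom splits into identities in which a single
argument lies in [V].  For the derivation identity these are [rep_theta_br] when
one of the first two arguments lies in [V], [rep_D_theta] for the third and the
fourth, and [rep_D_D] for the last. *)
Lemma semidirect_is_lts : is_lts semidirect.
Proof.
have [[bl1 bl2 bl3] skew cyc der] := ltsL.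
have [[tl1 tl2 tl3] _ _] := repV.
have DE x y u : D x y u = theta y x u - theta x y u by [].
(* Abstracting [D] prevents rewriting from seeing a difference inside it. *)
move: rep_D_trilinear rep_D_skew DE rep_theta_br rep_D_theta rep_D_D.
rewrite /semidirect; move: (rep_D theta) => d.
move=> [dl1 dl2 dl3] d_skew dE theta_br d_theta d_d.
split; first split.
- move=> [y v] [z w] a [x u] [x' u']; congr (_, _) => /=; first exact: bl1.
  rewrite dl1 tl3 tl1 opprD [in RHS]scalerBr [in RHS]scalerDr.
  by rewrite [LHS](AC (2*2*2) (1*3*5*(2*4*6))).
- move=> [x u] [z w] a [y v] [y' v']; congr (_, _) => /=; first exact: bl2.
  rewrite dl2 tl1 tl3 opprD [in RHS]scalerBr [in RHS]scalerDr.
  by rewrite [LHS](AC (2*2*2) (1*3*5*(2*4*6))).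
- move=> [x u] [y v] a [z w] [z' w']; congr (_, _) => /=; first exact: bl3.
  rewrite dl3 !tl2 opprD [in RHS]scalerBr [in RHS]scalerDr.
  by rewrite [LHS](AC (2*2*2) (1*3*5*(2*4*6))).
- move=> [x u] [y v] [z w]; congr (_, _) => /=; first exact: skew.
  by rewrite d_skew !opprD opprK addrAC.
- move=> [x u] [y v] [z w]; congr (_, _) => /=; first exact: cyc.
  (* Once [D] is expanded, the twelve terms cancel in pairs. *)
  rewrite !dE !addrA.
  rewrite [LHS](ACl ((1*8)*(11*2)*(3*6)*(9*4)*(5*12)*(7*10))).
  by rewrite /= !subrr !addr0.
- move=> [x u] [y v] [z w] [t q] [e r]; congr (_, _) => /=; first exact: der.
  rewrite !(linear_addE (dl3 _ _)) !(linear_oppE (dl3 _ _)).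
  rewrite !(linear_addE (tl3 _ _)) !(linear_oppE (tl3 _ _)).
  rewrite (d_d x) (d_theta x y t) (d_theta x y z).
  rewrite !(theta_br _ z t) !opprD !opprK !addrA.
  (* Left: five triples, one per argument in [V]; right: three values of the
     product, with five terms each. *)
  by rewrite [LHS](ACl (1*6*10*13*7*2*4*9*11*14*3*12*15*5*8)).
Qed.

End Semidirect.

(** * The graph of an O-operator *)

Section Graph.
Variables (K : fieldType) (L V : lmodType K) (T : {linear V -> L}).

Definition graph (u : V) : (L * V)%type := (T u, u).
Definition graph_proj (e : (L * V)%type) : L := e.1 - T e.2.
Definition incl_left (x : L) : (L * V)%type := (x, 0).

Fact graph_linear : linear graph.
Proof. by move=> a u v; rewrite /graph linearP. Qed.

Fact graph_proj_linear : linear graph_proj.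
Proof.
by move=> a [x u] [y v]; rewrite /graph_proj /= linearP scalerBr opprD addrACA.
Qed.

Fact incl_left_linear : linear incl_left.
Proof. by move=> a x y; congr (_, _); rewrite /= scaler0 addr0. Qed.

HB.instance Definition _ :=
  GRing.isLinear.Build K V (L * V)%type _ graph graph_linear.
HB.instance Definition _ :=
  GRing.isLinear.Build K (L * V)%type L _ graph_proj graph_proj_linear.
HB.instance Definition _ :=
  GRing.isLinear.Build K L (L * V)%type _ incl_left incl_left_linear.

Lemma graph_inj : injective graph.
Proof. by move=> u v []. Qed.

Lemma graph_proj_graph u : graph_proj (graph u) = 0.
Proof. exact: subrr. Qed.

Lemma graph_proj_eq0 e : graph_proj e = 0 -> exists u, e = graph u.
Proof. by case: e => x u /subr0_eq /= ->; exists u. Qed.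

Lemma incl_leftK : cancel incl_left graph_proj.
Proof. by move=> x; rewrite /graph_proj /= linear0 subr0. Qed.

Variables (br : L -> L -> L -> L) (theta : L -> L -> V -> V).

Lemma graph_bracket : is_O_operator br theta T -> forall u v w,
  graph (bracketT theta T u v w)
  = semidirect br theta (graph u) (graph v) (graph w).
Proof. by move=> opT u v w; rewrite /semidirect /= opT. Qed.

Lemma thetaT_quotient : trilinear theta -> forall u v x,
  thetaT br theta T u v x
  = quotient_theta (semidirect br theta) graph graph_proj incl_left u v x.
Proof.
move=> [_ _ lin3] u v x; rewrite /thetaT.
rewrite -[RHS]/(br x (T u) (T v) - T (rep_D theta x (T u) v
                  + theta (T u) (T v) 0 - theta x (T v) u)).
by rewrite (linear_zeroE (lin3 _ _)) addr0 -linearN [in RHS]opprB.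
Qed.

End Graph.

(** Congruence in place of an equality of functions, which would need functional
extensionality. *)
Lemma eq_is_representation (K : fieldType) (L V : lmodType K)
    (br : L -> L -> L -> L) (theta theta' : L -> L -> V -> V) :
    (forall x y u, theta x y u = theta' x y u) ->
  is_representation br theta' -> is_representation br theta.
Proof.
move=> eq_th [[lin1 lin2 lin3] ax1 ax2]; split; first split.
- by move=> y u a x x'; rewrite !eq_th lin1.
- by move=> x u a y y'; rewrite !eq_th lin2.
- by move=> x y a u u'; rewrite !eq_th lin3.
- by move=> x y z t u; rewrite /rep_D !eq_th -[RHS](ax1 x y z t u).
- by move=> x y z t u; rewrite /rep_D !eq_th -[RHS](ax2 x y z t u).
Qed.

Theorem proposition4p2 (K : fieldType) (charK0 : [pchar K] =i pred0)
    (L V : lmodType K) (br : L -> L -> L -> L) (theta : L -> L -> V -> V)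
    (T : {linear V -> L})
    (ltsL : is_lts br)
    (repV : is_representation br theta)
    (opT : is_O_operator br theta T) :
  is_lts (bracketT theta T) /\
  is_representation (bracketT theta T) (thetaT br theta T).
Proof.
have ltsE := semidirect_is_lts ltsL repV.
have gbr := graph_bracket opT.
split; first exact: (lts_restrict ltsE (@graph_inj _ _ _ T) gbr).
apply: eq_is_representation (thetaT_quotient T br (rep_trilinear repV)) _.
exact: (quotient_is_representation ltsE gbr (@graph_proj_graph _ _ _ T)
  (@graph_proj_eq0 _ _ _ T) (@incl_leftK _ _ _ T)).
Qed.
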